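(* Let $\theta,\eta$ be irrational real numbers such that $\varpi_\psi(\theta,\eta)>1$. Then $$\min(\omega(\theta),\omega(\eta))\ \ge\ \varpi_\psi(\theta,\eta)^2.$$
   Context: $\|x\|$ denotes the distance from the real number $x$ to the nearest integer, and $\mathbb{Z}_+$ is the set of positive integers. For an irrational real number $\theta$ and real $t\ge1$ define $$\psi_\theta(t)=\min_{q\in\mathbb{Z}_+:\,q\le t}\|q\theta\|,$$ and the ordinary Diophantine exponent $$\omega(\theta)=\sup\{\gamma\in\mathbb{R}:\ \liminf_{t\to\infty}t^{\gamma}\psi_\theta(t)<\infty\}\in[1,+\infty].$$ For two irrational real numbers $\theta,\eta$ define $\psi_{\theta,\eta}(t)=\min(\psi_\theta(t),\psi_\eta(t))$ and $$\varpi_\psi(\theta,\eta)=\sup\{\gamma\in\mathbb{R}:\ \limsup_{t\to\infty}t^{\gamma}\psi_{\theta,\eta}(t)<\infty\}\in[1,+\infty].$$ Convention: $(+\infty)^2=+\infty$. *)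

(* Defs.v *)
From mathcomp Require Import all_boot all_order all_algebra.
From mathcomp Require Import all_classical all_reals all_analysis.

Set Implicit Arguments.
Unset Strict Implicit.
Unset Printing Implicit Defensive.

Import Order.TTheory GRing.Theory Num.Theory.
Import numFieldNormedType.Exports.

Local Open Scope classical_set_scope.
Local Open Scope ring_scope.

Definition nint_dist (R : realType) (x : R) : R :=
  inf [set `|x - m%:~R| | m in [set: int]].

(* For t >= 1 the set is finite and nonempty, so that inf is its minimum.
   Only the values at large t enter the exponents below. *)
Definition psi (R : realType) (theta t : R) : R :=
  inf [set nint_dist (q%:R * theta) | q in [set q : nat | (0 < q)%N /\ q%:R <= t]].

Definition psi2 (R : realType) (theta eta t : R) : R :=
  Num.min (psi theta t) (psi eta t).

Definition omega (R : realType) (theta : R) : \bar R :=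
  ereal_sup [set g%:E | g in
    [set g : R | (limf_einf (fun t : R => (t `^ g * psi theta t)%:E) +oo%R
                  < +oo)%E]].

Definition varpi (R : realType) (theta eta : R) : \bar R :=
  ereal_sup [set g%:E | g in
    [set g : R | (limf_esup (fun t : R => (t `^ g * psi2 theta eta t)%:E) +oo%R
                  < +oo)%E]].

(* Main.v *)
(* Call q a record of theta if ||q theta|| < ||p theta|| for all 0 < p < q.  A
   2x2 determinant shows that then ||p theta|| >= 1/(2q) for 0 < p < q.  Let
   g > 1 be such that for every large m some 0 < q < m has ||q theta|| or
   ||q eta|| at most C m^-g; then theta has no such q when m is a large record of
   theta, so eta has one, and vice versa.  Take a large record s of eta and let
   q be the least index with ||q theta|| <= C s^-g.  It is a record of theta, so
   some r < q < s has ||r eta|| <= C q^-g, while ||r eta|| >= 1/(2s).  Hence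
   q^g <= 2 C s, and ||q theta|| <= C s^-g is O(q^(-g^2)). *)

Require Import Defs.
From mathcomp Require Import all_boot all_order all_algebra.
From mathcomp Require Import all_classical all_reals all_analysis.
From mathcomp Require Import zify ring lra.

Set Implicit Arguments.
Unset Strict Implicit.
Unset Printing Implicit Defensive.

Import Order.TTheory GRing.Theory Num.Theory.
Import numFieldNormedType.Exports.

Local Open Scope classical_set_scope.
Local Open Scope ring_scope.

Lemma powR_nat_unbounded (R : realType) (d K : R) : 0 < d ->
  exists M, forall m, (M <= m)%N -> K < m%:R `^ d.
Proof.
move=> d0; exists (Num.truncn ((`|K| + 1) `^ d^-1)).+1 => m Mm.
have k0 : 0 < `|K| + 1 by rewrite ltr_wpDl.
have h : (`|K| + 1) `^ d^-1 < m%:R.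
  by apply: lt_le_trans (truncnS_gt _) _; rewrite ler_nat.
have := gt0_ltr_powR d0 _ _ h; rewrite !nnegrE powR_ge0 ler0n => /(_ isT isT).
rewrite -powRrM mulVf ?gt_eqF// powRr1 ?ltW// => h'.
by apply: le_lt_trans h'; rewrite (le_trans (ler_norm K))// lerDl.
Qed.

(** * Distance to the nearest integer *)

Section nearest_integer.
Variable R : realType.
Implicit Types x theta : R.

Lemma nint_dist_ge0 x : 0 <= nint_dist x.
Proof.
apply: lb_le_inf; first by exists `|x - 0%:~R|, 0.
by move=> _ [m _ <-]; exact: normr_ge0.
Qed.

Lemma nint_dist_le x (k : int) : nint_dist x <= `|x - k%:~R|.
Proof.
apply: ge_inf; last by exists k.
by exists 0 => _ [m _ <-]; exact: normr_ge0.
Qed.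

(** Every integer is at most [floor x] or at least [floor x + 1], so one of these two realises the
    infimum. *)
Lemma nint_dist_attained x : exists m : int, nint_dist x = `|x - m%:~R|.
Proof.
suff [m mP] : exists m : int, forall k : int, `|x - m%:~R| <= `|x - k%:~R|.
  exists m; apply/eqP; rewrite eq_le nint_dist_le/=.
  apply: lb_le_inf; first by exists `|x - m%:~R|, m.
  by move=> _ [k _ <-].
have /andP[f1 f2] := floor_itv x; set f := Num.floor x in f1 f2.
rewrite intrD in f2.
have far (k : int) : x - f%:~R <= `|x - k%:~R| \/ f%:~R + 1 - x <= `|x - k%:~R|.
  have [kf|fk] := leP k f.
    left; apply: le_trans (ler_norm _).
    by rewrite lerD2l lerN2 ler_int.
  right; rewrite distrC; apply: le_trans (ler_norm _).
  by rewrite lerD2r -intrD1 ler_int lezD1.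
have [c|c] := leP (x - f%:~R) (f%:~R + 1 - x).
  exists f => k; rewrite ger0_norm ?subr_ge0//.
  by case: (far k) => // /(le_trans c).
exists (f + 1) => k; rewrite distrC ger0_norm ?subr_ge0 intrD ?(ltW f2)//.
by case: (far k) => // /(le_trans (ltW c)).
Qed.

Lemma nint_dist_irrational_gt0 theta q :
  irrational theta -> (0 < q)%N -> 0 < nint_dist (q%:R * theta).
Proof.
move=> irr q0; rewrite lt_neqAle nint_dist_ge0 andbT eq_sym; apply/eqP.
have [m ->] := nint_dist_attained (q%:R * theta).
move=> /eqP; rewrite normr_eq0 subr_eq0 => /eqP h; apply: irr.
have qR : q%:R != 0 :> R by rewrite pnatr_eq0 -lt0n.
exists (m%:~R / q%:R) => //; rewrite rmorphM fmorphV rmorph_int rmorph_nat -h.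
by rewrite mulrAC mulfV// mul1r.
Qed.

End nearest_integer.

(** * Records of a sequence and the determinant bound *)

Section records.
Variable R : realType.
Implicit Types a b : nat -> R.

Definition record a q := (0 < q)%N /\ forall p, (0 < p < q)%N -> a q < a p.

(** Besides positivity, this is all that the argument on two sequences uses about each single
    sequence [||q theta||]. *)
Definition record_gap a :=
  forall q p, record a q -> (0 < p < q)%N -> 1 <= 2 * q%:R * a p.

(** With [u], [v] the integers nearest to [p theta], [q theta], the determinant [q u - p v = p (q
    theta - v) - q (p theta - u)] is a nonzero integer, of absolute value at most [p ||q theta|| + q
    ||p theta|| < 2 q ||p theta||]. *)
Lemma nint_dist_record_gap (theta : R) :
  record_gap (fun q => nint_dist (q%:R * theta)).
Proof.
move=> q p [q0 qrec] /[dup] pq /andP[p0 ltpq].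
have := qrec _ pq.
have [u ->] := nint_dist_attained (p%:R * theta).
have [v ->] := nint_dist_attained (q%:R * theta) => lt_vu.
have pR : 0 < p%:R :> R by rewrite ltr0n.
have qR : 0 < q%:R :> R by rewrite ltr0n.
have pqR : p%:R < q%:R :> R by rewrite ltr_nat.
have lt_pv_qu := ltr_pM (ltW pR) (normr_ge0 _) pqR lt_vu.
(* A zero determinant would give [q ||p theta|| = p ||q theta||], against [lt_pv_qu]. *)
have [E|nE] := eqVneq (q%:Z * u) (p%:Z * v).
  have : q%:R * `|p%:R * theta - u%:~R| = p%:R * `|q%:R * theta - v%:~R|.
    rewrite -[X in X * _](gtr0_norm qR) -[in RHS](gtr0_norm pR) -!normrM.
    congr `|_|.
    have : q%:R * u%:~R = p%:R * v%:~R :> R.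
      by move/(congr1 (fun z : int => z%:~R : R)): E; rewrite !intrM.
    by rewrite !mulrBr => ->; ring.
  by move=> qu_pv; move: lt_pv_qu; rewrite qu_pv ltxx.
have det : 1 <= `|q%:R * u%:~R - p%:R * v%:~R| :> R.
  have -> : q%:R * u%:~R - p%:R * v%:~R = (q%:Z * u - p%:Z * v)%:~R :> R.
    by rewrite intrB !intrM.
  rewrite -intr_norm -[1]/(1%:~R) ler_int.
  by rewrite -gtz0_ge1 normr_gt0 subr_eq0.
apply: le_trans det _.
have -> : q%:R * u%:~R - p%:R * v%:~R =
    p%:R * (q%:R * theta - v%:~R) - q%:R * (p%:R * theta - u%:~R) by ring.
apply: le_trans (ler_normB _ _) _; rewrite !normrM !normr_nat.
lra.
Qed.

Lemma least_is_record a c : (exists2 p, (0 < p)%N & a p <= c) ->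
  exists q, [/\ record a q, a q <= c &
    forall p, (0 < p)%N -> a p <= c -> (q <= p)%N].
Proof.
move=> [p0 p00 ap0].
have ex : exists p, (0 < p)%N && (a p <= c) by exists p0; rewrite p00.
case: (ex_minnP ex) => q /andP[q0 aq] qmin; exists q; split => //.
- split=> // p /andP[p1 pq]; apply: le_lt_trans aq _; rewrite ltNge.
  apply/negP => ap.
  by have := qmin p; rewrite p1 ap leqNgt pq => /(_ isT).
- by move=> p p1 ap; apply: qmin; rewrite p1.
Qed.

Lemma positive_lower_bound a N : (forall p, (0 < p)%N -> 0 < a p) ->
  exists2 e, 0 < e & forall p, (0 < p <= N)%N -> e <= a p.
Proof.
move=> a0; elim: N => [|N [e e0 eP]]; first by exists 1 => // p; lia.
exists (Num.min e (a N.+1)); first by rewrite lt_min e0 a0.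
move=> p /andP[p0]; rewrite leq_eqVlt ltnS ge_min => /orP[/eqP->|pN].
  by rewrite lexx orbT.
by rewrite eP// p0.
Qed.

(** * Two sequences that are jointly small *)

Section two_sequences.
Variables g C : R.
Hypotheses (g1 : 1 < g) (C0 : 0 < C).

Let g0 : 0 < g. Proof. exact: lt_trans ltr01 g1. Qed.

(** The strict [q < m] lets the gap bound apply when [m] is a record. *)
Definition jointly_small a b N0 := forall m, (N0 <= m)%N ->
  exists2 q, (0 < q < m)%N & m%:R `^ g * a q <= C \/ m%:R `^ g * b q <= C.

(** Once [C / m^g] is below a positive lower bound of [a] on [1..N], the least index with a value
    under this threshold lies beyond [N]. *)
Lemma small_late_record a N : (forall p, (0 < p)%N -> 0 < a p) ->
  exists M, forall m, (M <= m)%N ->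
  (exists2 p, (0 < p)%N & m%:R `^ g * a p <= C) ->
  exists q, [/\ (N < q)%N, record a q, m%:R `^ g * a q <= C &
    forall p, (0 < p)%N -> m%:R `^ g * a p <= C -> (q <= p)%N].
Proof.
move=> a0; have [e e0 eP] := positive_lower_bound N a0.
have [M MP] := powR_nat_unbounded (C / e) g0.
exists M.+1 => m Mm [p p0 ap].
have mg0 : 0 < m%:R `^ g by rewrite powR_gt0// ltr0n; lia.
have smallE k : (m%:R `^ g * a k <= C) = (a k <= C / m%:R `^ g).
  by rewrite ler_pdivlMr// mulrC.
rewrite smallE in ap.
have [|q [qrec aq qmin]] := @least_is_record a (C / m%:R `^ g).
  by exists p.
exists q; split => //; first last.
- by move=> k k0; rewrite smallE; exact: qmin.
- by rewrite smallE.
rewrite ltnNge; apply/negP => qN; have [q0 _] := qrec.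
have := MP m (ltnW Mm); rewrite ltr_pdivrMr// ltNge => /negP; apply.
rewrite -smallE in aq; apply: le_trans aq.
by rewrite ler_pM2l// eP// q0.
Qed.

(* Since [g > 1], the gap bound contradicts smallness of [a] just before one of
   its records, so [b] takes over there. *)
Lemma small_before_record a b N0 : record_gap a -> jointly_small a b N0 ->
  exists M, forall m, (M <= m)%N -> record a m ->
  exists2 q, (0 < q < m)%N & m%:R `^ g * b q <= C.
Proof.
move=> agap ab; have g10 : 0 < g - 1 by rewrite subr_gt0.
have [M MP] := powR_nat_unbounded (2 * C) g10.
exists (maxn M N0) => m; rewrite geq_max => /andP[Mm N0m] mrec.
have [q qm [small|small]] := ab _ N0m; last by exists q.
have mR : 0 < m%:R :> R by rewrite ltr0n; case: mrec.
have gap := agap _ _ mrec qm; have := MP _ Mm.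
have mE : m%:R `^ g = m%:R `^ (g - 1) * m%:R.
  have mN0 : m%:R != 0 :> R by rewrite gt_eqF.
  by rewrite -[X in _ * X]powRr1 ?ltW// -powRD ?mN0 ?implybT// subrK.
move: small; rewrite mE; set X := m%:R `^ _ => small CX.
have X0 : 0 < X by exact: powR_gt0.
(* With [X m a q <= C] this gives [X <= 2 C], against the choice of [M]. *)
have : X * 1 <= X * (2 * m%:R * a q) by rewrite ler_pM2l.
lra.
Qed.

Lemma jointly_smallC a b N0 : jointly_small a b N0 -> jointly_small b a N0.
Proof.
by move=> ab m /ab[q qm [s|s]]; exists q => //; [right|left].
Qed.

(* If [b] had finitely many records it would be bounded away from 0, so [a]
   would be small at every large [m], also just before its own records. *)
Lemma unbounded_records a b N0 : (forall p, (0 < p)%N -> 0 < a p) ->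
  (forall p, (0 < p)%N -> 0 < b p) -> record_gap a ->
  jointly_small a b N0 -> forall N, exists2 s, (N < s)%N & record b s.
Proof.
move=> a0 b0 agap ab N.
have [e e0 eP] := positive_lower_bound N b0.
have [[p p0 bp]|bge] := pselect (exists2 p, (0 < p)%N & b p <= e / 2).
  have [|s [srec bs _]] := @least_is_record b (e / 2); first by exists p.
  exists s => //; rewrite ltnNge; apply/negP => sN; have [s0 _] := srec.
  by have := eP s; rewrite s0 sN => /(_ isT); lra.
have be p : (0 < p)%N -> e / 2 < b p.
  by move=> p0; rewrite ltNge; apply/negP => bp; apply: bge; exists p.
have e20 : 0 < e / 2 by rewrite divr_gt0.
have [M1 M1P] := powR_nat_unbounded (C / (e / 2)) g0.
have bbig m p : (M1 <= m)%N -> (0 < p)%N -> C < m%:R `^ g * b p.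
  move=> /M1P; rewrite ltr_pdivrMr// => CM p0; apply: lt_le_trans CM _.
  by rewrite ler_wpM2l ?powR_ge0// ltW// be.
have [M2 M2P] := small_before_record agap ab.
(* If [b] stays above [e / 2], a late record of [a] contradicts [small_before_record]. *)
have [M3 M3P] := small_late_record (maxn M1 M2) a0.
pose m := maxn N0 (maxn M1 M3).
have [||q [qM qrec _ _]] := M3P m; first by lia.
  have [|q /andP[q0 _] [small|]] := ab m; first by lia.
    by exists q.
  by rewrite leNgt bbig//; lia.
have [|p /andP[p0 _]] := M2P q _ qrec; first by lia.
by rewrite leNgt bbig//; lia.
Qed.

Lemma small_infinitely_often a b N0 : (forall p, (0 < p)%N -> 0 < a p) ->
  (forall p, (0 < p)%N -> 0 < b p) -> record_gap a -> record_gap b ->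
  jointly_small a b N0 ->
  forall N, exists2 q, (N < q)%N & q%:R `^ (g * g) * a q <= (2 * C) `^ g * C.
Proof.
move=> a0 b0 agap bgap ab N.
have [M1 M1P] := small_before_record agap ab.
have [M2 M2P] := small_before_record bgap (jointly_smallC ab).
have [M3 M3P] := small_late_record (maxn N M1) a0.
have [s sM srec] := unbounded_records a0 b0 agap ab (maxn M2 M3).
have [|p /andP[p0 ps] ap] := M2P s _ srec; first by lia.
have [||q [qM qrec aq qmin]] := M3P s; [by lia|by exists p|].
have qp := qmin _ p0 ap.
have [|r /andP[r0 rq] br] := M1P q _ qrec; first by lia.
exists q; first by lia.
(* Since [q] is least, [r < q <= p < s], so the gap bound of [b] at the record [s] applies to
   [r]. *)
have := bgap _ r srec; rewrite r0 (leq_trans rq (leq_trans qp (ltnW ps))).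
move=> /(_ isT) gap.
have qg0 : 0 <= q%:R `^ g by exact: powR_ge0.
(* Multiply [1 <= 2 s b r] by [q^g] and use [q^g b r <= C]. *)
have qs : q%:R `^ g <= 2 * C * s%:R.
  rewrite -[leLHS]mulr1; apply: le_trans (ler_wpM2l qg0 gap) _.
  by have := ler_wpM2l (ler0n R s) br; lra.
have qgg : q%:R `^ (g * g) <= (2 * C) `^ g * s%:R `^ g.
  have C2 : 0 <= 2 * C by rewrite mulr_ge0// ltW.
  by rewrite powRrM -powRM// ge0_ler_powR ?nnegrE ?mulr_ge0// ltW.
have q0 : (0 < q)%N by case: qrec.
apply: le_trans (ler_wpM2r (ltW (a0 _ q0)) qgg) _.
by rewrite -mulrA ler_wpM2l ?powR_ge0.
Qed.

End two_sequences.
End records.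

(** * From the exponents to sequences and back *)

Section exponents.
Variable R : realType.
Implicit Types (theta eta g : R) (f : R -> R).

Lemma limf_esup_lty f :
  (limf_esup (fun t => (f t)%:E) +oo%R < +oo)%E ->
  exists C, \forall t \near +oo, f t <= C.
Proof.
move=> /ereal_inf_lt[_ [V Voo <-] supV].
have [t0 Vt0] := filter_ex Voo.
have ub t : V t -> ((f t)%:E <= ereal_sup [set (f x)%:E | x in V])%E.
  by move=> Vt; apply: ereal_sup_ubound; exists t.
(* The supremum is finite: it is below [+oo] by the choice of [V], and [V] is nonempty. *)
exists (fine (ereal_sup [set (f x)%:E | x in V])).
apply: filterS Voo => t /ub; rewrite -lee_fin fineK// fin_numE.
by rewrite -ltey supV andbT -ltNye (lt_le_trans (ltNyr _) (ub _ Vt0)).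
Qed.

Lemma limf_einf_lty f C :
  (forall T, exists2 t, T < t & f t <= C) ->
  (limf_einf (fun t => (f t)%:E) +oo%R < +oo)%E.
Proof.
move=> often; apply: (@le_lt_trans _ _ C%:E); last exact: ltry.
rewrite /limf_einf leeNl; apply: le_ereal_inf_tmp => _ [V [T [_ TV]] <-].
have [t Tt ft] := often T.
apply: le_ereal_sup_tmp; exists (- (f t)%:E)%E; first by exists t => //; exact: TV.
by rewrite leeN2 lee_fin.
Qed.

Lemma psi_lt theta t c : 1 <= t -> psi theta t < c ->
  exists q, [/\ (0 < q)%N, q%:R <= t & nint_dist (q%:R * theta) < c].
Proof.
move=> t1 /inf_lt[]; first by exists (nint_dist (1%:R * theta)), 1%N.
by move=> _ [q [q0 qt] <-] qc; exists q.
Qed.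

Lemma psi_le theta q : (0 < q)%N -> psi theta q%:R <= nint_dist (q%:R * theta).
Proof.
move=> q0; apply: ge_inf; last by exists q.
by exists 0 => _ [k _ <-]; exact: nint_dist_ge0.
Qed.

(** Evaluating at [t = m / 2] turns [q <= t] into [q < m], at the cost of a factor [2^g] in the
    constant. *)
Lemma varpi_jointly_small theta eta g : 0 < g ->
  (limf_esup (fun t => (t `^ g * psi2 theta eta t)%:E) +oo%R < +oo)%E ->
  exists2 C, 0 < C & exists N0, jointly_small g C
    (fun q => nint_dist (q%:R * theta)) (fun q => nint_dist (q%:R * eta)) N0.
Proof.
move=> g0 /limf_esup_lty[C [T [_ TC]]].
(* The added 1 makes [D] positive and the bound on [psi2] strict, so some [q] lies below it without
   the infimum being attained. *)
pose D := `|C| + 1; have D0 : 0 < D by rewrite ltr_wpDl.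
exists (2 `^ g * D); first by rewrite mulr_gt0 ?powR_gt0.
(* This threshold ensures both [t >= 1] and [t > T]. *)
exists (Num.truncn (2 * `|T|)).+2 => m Nm.
have m2 : 2 <= m%:R :> R by rewrite ler_nat; lia.
have Tm : T < m%:R / 2.
  apply: le_lt_trans (ler_norm T) _; rewrite ltr_pdivlMr// mulrC.
  by apply: lt_le_trans (truncnS_gt _) _; rewrite ler_nat ltnW.
set t := m%:R / 2 in Tm; have t1 : 1 <= t by rewrite ler_pdivlMr// mul1r.
have t0 : 0 < t by lra.
have tg0 : 0 < t `^ g by exact: powR_gt0.
have : psi2 theta eta t < D / t `^ g.
  rewrite ltr_pdivlMr// mulrC; apply: le_lt_trans (TC _ Tm) _.
  by apply: le_lt_trans (ler_norm C) _; rewrite ltrDl.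
have mE : m%:R `^ g = 2 `^ g * t `^ g.
  by rewrite -powRM ?(ltW t0)// /t mulrC divfK.
have bnd x : x < D / t `^ g -> m%:R `^ g * x <= 2 `^ g * D.
  rewrite ltr_pdivlMr// => /ltW xD.
  by rewrite mE -mulrA ler_wpM2l ?powR_ge0// mulrC.
have lt_m q : q%:R <= t -> (q < m)%N.
  by move=> qt; rewrite -(ltr_nat R); apply: le_lt_trans qt _; rewrite /t; lra.
rewrite gt_min => /orP[] /(psi_lt t1)[q [q0 qt qD]]; exists q;
  rewrite ?q0 ?lt_m//; [left|right]; exact: bnd.
Qed.

Lemma sqr_le_omega theta eta g : irrational theta -> irrational eta -> 1 < g ->
  (limf_esup (fun t => (t `^ g * psi2 theta eta t)%:E) +oo%R < +oo)%E ->
  ((g * g)%:E <= omega theta)%E.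
Proof.
move=> tirr eirr g1 lim.
have g0 : 0 < g by exact: lt_trans ltr01 g1.
have [C C0 [N0 small]] := varpi_jointly_small g0 lim.
apply: ereal_sup_ubound; exists (g * g) => //=.
apply: (@limf_einf_lty _ ((2 * C) `^ g * C)) => T.
have [||||q Tq qC] := small_infinitely_often g1 C0 _ _ _ _ small (Num.truncn T).
- by move=> p; exact: nint_dist_irrational_gt0.
- by move=> p; exact: nint_dist_irrational_gt0.
- exact: nint_dist_record_gap.
- exact: nint_dist_record_gap.
exists q%:R; first by apply: lt_le_trans (truncnS_gt _) _; rewrite ler_nat.
apply: le_trans qC; rewrite ler_wpM2l ?powR_ge0// psi_le//; lia.
Qed.

Lemma psi2C theta eta : psi2 theta eta = psi2 eta theta.
Proof. by apply/funext => t; rewrite /psi2 minC. Qed.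

Lemma varpiC theta eta : varpi theta eta = varpi eta theta.
Proof. by rewrite /varpi psi2C. Qed.

(** The supremum [varpi] may be infinite or not attained. If its square exceeded [omega theta], the
    latter would be a finite [w] with [sqrt w < varpi], and an admissible [g > sqrt w] would give
    [g * g <= w]. *)
Lemma varpi_sqr_le_omega theta eta : irrational theta -> irrational eta ->
  (1 < varpi theta eta)%E -> (varpi theta eta ^+ 2 <= omega theta)%E.
Proof.
move=> tirr eirr v1.
have key (r : R) : 1 <= r -> (r%:E < varpi theta eta)%E ->
    exists2 g, r < g & ((g * g)%:E <= omega theta)%E.
  move=> r1 /ereal_sup_gt[_ [g lim <-]]; rewrite lte_fin => rg.
  by exists g => //; apply: sqr_le_omega lim => //; exact: le_lt_trans rg.
rewrite leNgt; apply/negP => lt_omega.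
(* This gives [omega theta > 1], so that [key] can later be applied at [sqrt w >= 1]. *)
have [g g1 gom] := key 1 (lexx _) v1.
have om1 : (1 < omega theta)%E.
  by apply: lt_le_trans gom; rewrite lte_fin; nra.
have omfin : omega theta \is a fin_num.
  rewrite fin_numE -ltNye -ltey (lt_trans (ltNyr _) om1)/=.
  exact: lt_le_trans lt_omega (leey _).
move: lt_omega om1 key; rewrite -(fineK omfin); set w := fine _.
rewrite lte_fin => wv w1 key.
have w0 : 0 <= w by lra.
have [||h wh] := key (Num.sqrt w).
- by rewrite -sqrtr1 ler_sqrt//; lra.
- rewrite ltNge; apply/negP => vw; move: wv; rewrite ltNge => /negP; apply.
  have -> : w%:E = ((Num.sqrt w)%:E * (Num.sqrt w)%:E)%E.
    by rewrite -EFinM -expr2 sqr_sqrtr.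
  by rewrite expe2 lee_pmul// ltW// (lt_trans _ v1).
rewrite lee_fin leNgt => /negP; apply; rewrite -[ltLHS](sqr_sqrtr w0) expr2.
by have := sqrtr_ge0 w; nra.
Qed.

End exponents.

Theorem theorem2 (R : realType) (theta eta : R)
    (theta_irr : irrational theta) (eta_irr : irrational eta)
    (varpi_gt1 : (1 < varpi theta eta)%E) :
  (varpi theta eta ^+ 2 <= mine (omega theta) (omega eta))%E.
Proof.
rewrite le_min; apply/andP; split; first exact: varpi_sqr_le_omega.
rewrite varpiC; rewrite varpiC in varpi_gt1.
exact: varpi_sqr_le_omega eta_irr theta_irr varpi_gt1.
Qed.
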